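(* There are outer-string graphs that are not segment graphs.
   Context: Graphs are finite and simple. For a nonempty family $\mathcal{F}$ of subsets of $\mathbb{R}^2$, the intersection graph $\mathrm{Int}(\mathcal{F})$ has vertex set $\mathcal{F}$, and two distinct members $A,B\in\mathcal{F}$ are adjacent if and only if $A\cap B\neq\emptyset$. A family $\mathcal{F}$ is an intersection model of a graph $G$ if $G$ is isomorphic to $\mathrm{Int}(\mathcal{F})$. - An outer-string graph is a graph that has an intersection model consisting of curves lying in a (common) disk such that each curve has an endpoint on the boundary of the disk. - A segment graph is a graph that has an intersection model consisting of straight-line segments in the plane. *)

(* Defs.v *)
From mathcomp Require Import all_boot all_order all_algebra.
From mathcomp Require Import all_classical all_reals all_analysis.

Set Implicit Arguments.
Unset Strict Implicit.
Unset Printing Implicit Defensive.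

Import Order.TTheory GRing.Theory Num.Theory.
Import numFieldNormedType.Exports.
Local Open Scope classical_set_scope.
Local Open Scope ring_scope.

Definition graph_isomorphic (V W : Type)
    (adjV : V -> V -> Prop) (adjW : W -> W -> Prop) : Prop :=
  exists2 f : V -> W, bijective f &
    forall u v : V, adjV u v <-> adjW (f u) (f v).

(* The vertices of the intersection graph are the members of the set F, so
   repeated members are not allowed. *)
Definition Int_adj (U : Type) (F : set (set U)) (A B : F) : Prop :=
  A <> B /\ (val A `&` val B) !=set0.

Definition intersection_model (T : finType) (e : rel T) (U : Type)
    (F : set (set U)) : Prop :=
  F !=set0 /\
  graph_isomorphic (fun u v : T => e u v : Prop) (@Int_adj U F).

Section Plane.
Variable R : realType.

(* The library norm on R * R is the sup norm, hence the explicit Euclidean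
   distance. *)
Definition sqr_dist (p q : R * R) : R :=
  (p.1 - q.1) ^+ 2 + (p.2 - q.2) ^+ 2.

Definition disk (c : R * R) (r : R) : set (R * R) :=
  [set p | sqr_dist p c <= r ^+ 2].

Definition circle (c : R * R) (r : R) : set (R * R) :=
  [set p | sqr_dist p c = r ^+ 2].

(* Curves are continuous images of [0, 1]; g need not be injective. *)
Definition grounded_curve (c : R * R) (r : R) (A : set (R * R)) : Prop :=
  exists g : R -> R * R,
    [/\ {within `[0, 1], continuous g},
        A = g @` `[0, 1],
        A `<=` disk c r &
        circle c r (g 0) \/ circle c r (g 1)].

Definition outer_string_graph (T : finType) (e : rel T) : Prop :=
  exists F : set (set (R * R)),
    intersection_model e F /\
    exists c : R * R, exists2 r : R, 0 < r &
      forall A, F A -> grounded_curve c r A.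

(* Degenerate segments (a = b) are allowed. *)
Definition segment (a b : R * R) : set (R * R) :=
  (fun t : R => (line_path a.1 b.1 t, line_path a.2 b.2 t)) @` `[0, 1].

Definition segment_graph (T : finType) (e : rel T) : Prop :=
  exists F : set (set (R * R)),
    intersection_model e F /\
    forall A, F A -> exists a b : R * R, A = segment a b.

End Plane.

(* Main.v *)
Require Import Defs.
From mathcomp Require Import all_boot all_order all_algebra.
From mathcomp Require Import all_classical all_reals all_analysis.
From mathcomp Require Import ring lra.

(** The witness is a split graph: an independent set of m vertices, a clique
indexed by all the subsets of the independent set, and i adjacent to A exactly
when i belongs to A. So every subset of the independent part is the
neighbourhood of a vertex.

Segments are too rigid for that. Whether two segments meet is decided by the
signs of twelve quantities ([segments_meetP]): four orientations, each with both
signs, and four comparisons of coordinate ranges. Each quantity is a bilinear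
pairing of a vector in dimension 3 attached to one segment with such a vector
attached to the other. Against m fixed segments, one such sign cuts out at most
(m + 1)^3 different subsets ([few_traces_gt0]): otherwise the Sauer-Shelah lemma
([sauer_shelah]) would give four indices on which all the sign patterns occur,
but four vectors in dimension 3 satisfy a linear relation, and no vector can be
positive exactly on those with a positive coefficient. Hence segments realise at
most (m + 1)^36 neighbourhoods, which is less than 2^m for m = 400.

Outer-strings are flexible enough. The independent vertices become points on an
arc of the unit circle, and the vertex A becomes a curve that runs along the
same arc, pulled inside the disk except at prescribed parameters, where it
touches the circle: those of the points i in A, one at the start of the arc,
common to all the curves, which makes them a clique grounded on the boundary,
and one private to A, which makes the curves distinct
([split_outer_string]). *)

Set Implicit Arguments.
Unset Strict Implicit.
Unset Printing Implicit Defensive.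

Import Order.TTheory GRing.Theory Num.Theory.
Import numFieldNormedType.Exports.
Local Open Scope ring_scope.

(** * The Sauer-Shelah lemma *)

Section Shattering.
Variable T : finType.
Implicit Types (F : {set {set T}}) (A B D X : {set T}).

Definition shatters F A :=
  [forall B : {set T}, (B \subset A) ==> [exists X in F, X :&: A == B]].

Lemma shattersP F A :
  reflect (forall B, B \subset A -> exists2 X, X \in F & X :&: A = B)
          (shatters F A).
Proof.
apply: (iffP forallP) => [sh B BA|sh B].
  by have /implyP/(_ BA)/existsP[X /andP[XF /eqP]] := sh B; exists X.
apply/implyP => /sh[X XF XA]; apply/existsP; exists X.
by rewrite XF XA eqxx.
Qed.

(** Pajor's form of the Sauer-Shelah lemma, by induction on D. Removing a point x
splits F into the members F0 avoiding x and the traces F1 of those containing x.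
A set shattered by F0 or by F1 is shattered by F, and a set shattered by both
remains so after adding x, since x can then be included or not at will. *)
Lemma card_le_shattered D F :
  (forall X, X \in F -> X \subset D) ->
  (#|F| <= #|[set A in powerset D | shatters F A]%SET|)%N.
Proof.
have [n] := ubnP #|D|; elim: n => // n IHn in D F *.
rewrite ltnS => Dn FD; have [D0|[x xD]] := set_0Vmem D.
  have [->|[X XF]] := set_0Vmem F; first by rewrite cards0.
  have Fsub : F \subset [set finset.set0].
    by apply/fintype.subsetP => Y /FD; rewrite D0 finset.subset0 inE.
  rewrite (leq_trans (subset_leq_card Fsub)) // cards1 card_gt0.
  apply/set0Pn; exists finset.set0; rewrite inE powersetE finset.sub0set /=.
  apply/shattersP => B; rewrite finset.subset0 => /eqP ->; exists X => //.
  by rewrite finset.setI0.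
pose F0 := [set X in F | x \notin X]%SET.
pose F1 := [set X :\ x | X in [set X in F | x \in X]]%SET.
have cardF : #|F| = (#|F0| + #|F1|)%N.
  rewrite card_in_imset => [|X Y]; last first.
    rewrite !inE => /andP[_ xX] /andP[_ xY] XY.
    by rewrite -(finset.setD1K xX) XY finset.setD1K.
  rewrite -(cardsID [set X : {set T} | x \in X] F) addnC.
  by congr (_ + _)%N; apply: eq_card => X; rewrite !inE // andbC.
pose sh G := [set A in powerset (D :\ x) | shatters G A]%SET.
have small : (#|D :\ x| < n)%N by move: Dn; rewrite (cardsD1 x D) xD.
have F0sh : (#|F0| <= #|sh F0|)%N.
  apply: IHn => // X; rewrite inE => /andP[XF xX].
  by rewrite finset.subsetD1 xX FD.
have F1sh : (#|F1| <= #|sh F1|)%N.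
  apply: IHn => // X /imsetP[Y]; rewrite inE => /andP[YF _] ->.
  by rewrite finset.setSD ?FD.
(* The sets shattered by both families are counted twice, so one of the two
   copies is charged to the set with x added. *)
rewrite cardF (leq_trans (leq_add F0sh F1sh)) // -cardsUI.
have notinx A : A \subset D :\ x -> x \notin A.
  by rewrite finset.subsetD1 => /andP[].
rewrite -(@card_in_imset _ _ (fun A => x |: A) (sh F0 :&: sh F1)%SET); last first.
  move=> A B; rewrite !inE => /andP[/andP[/notinx xA _] _].
  move=> /andP[/andP[/notinx xB _] _] AB.
  by rewrite -(finset.setU1K xA) AB finset.setU1K.
rewrite -cardsUI [X in (_ + X)%N](_ : _ = 0)%N ?addn0; last first.
  apply/eqP; rewrite cards_eq0 -finset.subset0; apply/fintype.subsetP => A.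
  rewrite finset.in_setI => /andP[] AU /imsetP[B _ AB]; move: AU.
  rewrite !inE => /orP[] /andP[/notinx]; by rewrite AB !inE eqxx.
apply/subset_leq_card/fintype.subsetP => A; rewrite finset.in_setU => /orP[|].
  rewrite finset.in_setU => /orP[] /[!inE] /andP[AD] /shattersP sA;
    rewrite (fintype.subset_trans AD (finset.subD1set D x)) /=; apply/shattersP => B /sA.
    by move=> [X]; rewrite inE => /andP[XF _] <-; exists X.
  move=> [_ /imsetP[X /[!inE] /andP[XF _] ->] <-]; exists X => //.
  apply/setP => y; rewrite !inE; case: eqP => //= ->.
  by rewrite (negbTE (notinx _ AD)) andbF.
move=> /imsetP[C]; rewrite !inE.
move=> /andP[/andP[CD /shattersP s0] /andP[_ /shattersP s1]] ->.
have xC := notinx _ CD.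
rewrite finset.subUset finset.sub1set xD (fintype.subset_trans CD (finset.subD1set D x)) /=.
apply/shattersP => B BC.
have BxC : B :\ x \subset C.
  by apply/fintype.subsetP => y; rewrite !inE => /andP[/negbTE yx /(fintype.subsetP BC)];
    rewrite !inE yx.
have [xB|xB] := boolP (x \in B).
  have [_ /imsetP[X /[!inE] /andP[XF xX] ->] XB] := s1 _ BxC; exists X => //.
  apply/setP => y; move/setP/(_ y): XB; rewrite !inE.
  by case: eqP => [->|] //=; rewrite xX xB.
have [X /[!inE] /andP[XF xX] XB] := s0 _ BxC; exists X => //.
apply/setP => y; move/setP/(_ y): XB; rewrite !inE.
by case: eqP => [->|] //=; rewrite (negbTE xX) (negbTE xB).
Qed.

(** The bound (n + 1)^d on the number of subsets with at most d elements is
crude but needs no binomial sums: such a subset is the set of values of a map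
from 'I_d to T extended by a dummy point. *)
Lemma sauer_shelah F d :
  (forall A, shatters F A -> (#|A| <= d)%N) -> (#|F| <= #|T|.+1 ^ d)%N.
Proof.
move=> Fd; have := @card_le_shattered finset.setT F (fun X _ => finset.subsetT X).
move=> /leq_trans; apply.
pose range (f : {ffun 'I_d -> option T}) := [set x | Some x \in codom f]%SET.
rewrite -card_option -[d]card_ord -card_ffun.
apply: leq_trans (leq_imset_card range _).
apply/subset_leq_card/fintype.subsetP => A; rewrite !inE => /andP[_ /Fd Ad].
apply/imsetP; exists [ffun k : 'I_d => nth None [seq Some x | x <- enum A] k] => //.
apply/setP => x; rewrite inE; apply/idP/codomP => [xA|[k]].
  have kd : (index x (enum A) < d)%N.
    by apply: leq_trans Ad; rewrite cardE index_mem mem_enum.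
  exists (Ordinal kd); rewrite ffunE /= (nth_map x) ?nth_index ?mem_enum //.
  by rewrite index_mem mem_enum.
rewrite ffunE; have [kA|kA] := ltnP k (size (enum A)); last first.
  by rewrite nth_default ?size_map.
by rewrite (nth_map x) // => -[->]; rewrite -mem_enum mem_nth.
Qed.

End Shattering.

(** * Families of traces of a relation *)

Section TraceCount.
Variables I J : finType.
Implicit Types E : I -> J -> bool.

Definition traces E : {set {set I}} := [set [set i | E i j] | j : J]%SET.

(** The traces of a Boolean combination are determined by the pair of traces of
its components. *)
Lemma card_traces_op (op : bool -> bool -> bool) E1 E2 :
  (#|traces (fun i j => op (E1 i j) (E2 i j))| <=
     #|traces E1| * #|traces E2|)%N.
Proof.
rewrite -cardsX.
pose f (XY : {set I} * {set I}) := [set i | op (i \in XY.1) (i \in XY.2)]%SET.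
apply: leq_trans (leq_imset_card f _).
apply/subset_leq_card/fintype.subsetP => _ /imsetP[j _ ->].
apply/imsetP; exists ([set i | E1 i j], [set i | E2 i j])%SET.
  by rewrite finset.in_setX; apply/andP; split; apply: imset_f.
by apply/setP => i; rewrite !inE.
Qed.

End TraceCount.

(** * Sign patterns of matrices of low rank *)

Section SignRank.
Variables (R : realFieldType) (I J : finType).
Implicit Types (E : I -> J -> bool) (f g : I -> J -> R).

Definition rank_le d f :=
  exists (u : I -> 'rV[R]_d) (v : J -> 'cV[R]_d),
    forall i j, f i j = (u i *m v j) 0 0.

Lemma rank_leN d f : rank_le d f -> rank_le d (fun i j => - f i j).
Proof.
move=> [u [v fE]]; exists (fun i => - u i), v => i j.
by rewrite fE mulNmx [RHS]mxE.
Qed.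

Lemma rank_le3 (u1 u2 u3 : I -> R) (v1 v2 v3 : J -> R) f :
  (forall i j, f i j = u1 i * v1 j + u2 i * v2 j + u3 i * v3 j) ->
  rank_le 3 f.
Proof.
move=> fE; exists (fun i => \row_k [:: u1 i; u2 i; u3 i]`_k).
exists (fun j => \col_k [:: v1 j; v2 j; v3 j]`_k) => i j.
by rewrite fE mxE !big_ord_recl big_ord0 !mxE /= addr0 addrA.
Qed.

Definition few_traces d E := (#|traces E| <= #|I|.+1 ^ d)%N.

(** This is why the bound is kept in the form of a power: exponents add up. *)
Lemma few_traces_op (op : bool -> bool -> bool) d1 d2 E1 E2 :
  few_traces d1 E1 -> few_traces d2 E2 ->
  few_traces (d1 + d2) (fun i j => op (E1 i j) (E2 i j)).
Proof.
move=> E1d E2d; rewrite /few_traces expnD.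
exact: leq_trans (card_traces_op op E1 E2) (leq_mul E1d E2d).
Qed.

(** A shattered set with more than d elements carries a linear relation c between
its vectors. Shattering yields a column v that is positive exactly where c is
positive; the relation evaluated at v is then a sum of nonnegative terms, one of
which is positive, and yet it vanishes. *)
Lemma few_traces_gt0 d f : rank_le d f -> few_traces d (fun i j => 0 < f i j).
Proof.
move=> [u [v fE]]; apply: sauer_shelah => A /shattersP shA.
rewrite leqNgt; apply/negP => dA.
pose U := \matrix_(k < #|A|, l < d) u (enum_val k) 0 l.
have [c cpos cU] : exists2 c : 'rV[R]_#|A|,
    exists k, 0 < c 0 k & c *m U = 0.
  have : kermx U != 0.
    rewrite kermx_eq0 /row_free neq_ltn (leq_ltn_trans (rank_leq_col U)) //.
  case/rowV0Pn => c /sub_kermxP cU /rV0Pn[k]; rewrite neq_lt => /orP[] ck0.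
    exists (- c); first by exists k; rewrite mxE oppr_gt0.
    by rewrite mulNmx cU oppr0.
  by exists c => //; exists k.
pose B := [set enum_val k | k : 'I_#|A| & 0 < c 0 k]%SET.
have BA : B \subset A.
  by apply/fintype.subsetP => _ /imsetP[k _ ->]; apply: enum_valP.
have [_ /imsetP[j _ ->] XB] := shA B BA.
have fB k : (0 < f (enum_val k) j) = (0 < c 0 k).
  have := congr1 (fun X : {set I} => enum_val k \in X) XB.
  rewrite !inE enum_valP andbT => ->; apply/imsetP/idP => [[l]|ck].
    by rewrite inE => cl /enum_val_inj ->.
  by exists k; rewrite ?inE.
have sum0 : \sum_k c 0 k * f (enum_val k) j = 0.
  transitivity ((c *m U *m v j) 0 0); last by rewrite cU mul0mx mxE.
  rewrite -mulmxA mxE; apply: eq_bigr => k _; congr (_ * _).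
  by rewrite fE !mxE; apply: eq_bigr => l _; rewrite mxE.
have term0 k : 0 <= c 0 k * f (enum_val k) j.
  have := fB k; case: (ltrP 0 (c 0 k)) => ck.
    by move=> fk; rewrite mulr_ge0 // ltW.
  by move/negbT; rewrite -leNgt => fk; rewrite mulr_le0.
have [k ck] := cpos.
have /eqP : c 0 k * f (enum_val k) j = 0.
  exact: psumr_eq0P (fun k _ => term0 k) sum0 _ isT.
by rewrite mulf_eq0 !gt_eqF // fB.
Qed.

(** The sign conditions are all written in the form 0 < _, to match
[few_traces_gt0]. *)
Definition same_sign (x y : R) :=
  (0 < x) && (0 < y) || (0 < - x) && (0 < - y).

Lemma few_traces_same_sign d f g : rank_le d f -> rank_le d g ->
  few_traces (d + d + (d + d)) (fun i j => same_sign (f i j) (g i j)).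
Proof.
move=> fd gd; apply: (few_traces_op orb).
  by apply: (few_traces_op andb); apply: few_traces_gt0.
by apply: (few_traces_op andb); apply: few_traces_gt0; apply: rank_leN.
Qed.

End SignRank.

Local Open Scope classical_set_scope.
Local Open Scope ring_scope.

(** * Intersection of segments as a sign condition *)

Section Segments.
Variable R : realType.
Implicit Types a b p q z : R * R.

(** Twice the signed area of the triangle a b p. *)
Definition orient a b p : R :=
  (b.1 - a.1) * (p.2 - a.2) - (b.2 - a.2) * (p.1 - a.1).

Definition gap (a b p q : R) :=
  (0 < Num.min p q - Num.max a b) || (0 < Num.min a b - Num.max p q).

(** The separating-axis test, along the normals to the two segments and along the
two coordinate axes. The normals suffice unless all four endpoints are on one
line; the axes handle that case, which includes segments reduced to points. *)
Definition separated a b p q :=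
  [|| same_sign (orient a b p) (orient a b q),
      same_sign (orient p q a) (orient p q b),
      gap a.1 b.1 p.1 q.1 | gap a.2 b.2 p.2 q.2].

Lemma line_path_min_max (x y t : R) : 0 <= t <= 1 ->
  Num.min x y <= line_path x y t <= Num.max x y.
Proof.
rewrite /line_path; case: (lerP x y) => xy /andP[t0 t1]; apply/andP; nra.
Qed.

Lemma min_max_line_path (x y z : R) : Num.min x y <= z <= Num.max x y ->
  exists2 t, 0 <= t <= 1 & line_path x y t = z.
Proof.
move=> zxy; have [xy|xy] := eqVneq x y.
  exists 0; first by rewrite lexx ler01.
  by move: zxy; rewrite line_path0 xy minxx maxxx -eq_le => /eqP.
exists ((z - x) / (y - x)); last first.
  by rewrite line_pathEl divfK ?subrK // subr_eq0 eq_sym.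
move: zxy xy; case: (ltgtP x y) => // xy /andP[zl zr] _.
  rewrite divr_ge0 ?subr_ge0 ?(ltW xy) //.
  by rewrite ler_pdivrMr ?subr_gt0 // mul1r lerD2r.
rewrite -mulrNN -invrN !opprB divr_ge0 ?subr_ge0 ?(ltW xy) //.
by rewrite ler_pdivrMr ?subr_gt0 // mul1r lerD2l lerN2.
Qed.

Lemma gapP (a b p q : R) :
  reflect (exists s t, [/\ 0 <= s <= 1, 0 <= t <= 1 &
             line_path a b s = line_path p q t])
          (~~ gap a b p q).
Proof.
rewrite /gap negb_or !subr_gt0 -!leNgt; apply: (iffP andP) => [[pb aq]|].
  (* The larger of the two lower ends lies in both ranges. *)
  have [|s s01 sE] :=
      @min_max_line_path a b (Num.max (Num.min a b) (Num.min p q)).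
    by rewrite le_max lexx ge_max pb andbT /= ge_min le_max lexx.
  have [|t t01 tE] :=
      @min_max_line_path p q (Num.max (Num.min a b) (Num.min p q)).
    by rewrite le_max lexx orbT ge_max aq /= ge_min le_max lexx.
  by exists s, t; split; rewrite // sE tE.
move=> [s [t [/(line_path_min_max a b) /andP[al ar]]]].
move=> /(line_path_min_max p q) /andP[pl pr] e.
by split; [rewrite (le_trans pl) // -e|rewrite (le_trans al) // e].
Qed.

Lemma same_signP (x y : R) :
  reflect (exists2 t, 0 <= t <= 1 & line_path x y t = 0) (~~ same_sign x y).
Proof.
apply: (iffP idP) => [xy|[t t01 e]].
  apply: min_max_line_path; move: xy; rewrite /same_sign !oppr_gt0.
  by case: (lerP x y); case: (ltrgtP 0 x); case: (ltrgtP 0 y) => //=; lra.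
have := line_path_min_max x y t01; rewrite e /same_sign !oppr_gt0.
by rewrite ge_min le_max; case: (ltrgtP 0 x); case: (ltrgtP 0 y).
Qed.

Definition segment_point a b t : R * R :=
  (line_path a.1 b.1 t, line_path a.2 b.2 t).

Lemma orient_segment_point p q a b t :
  orient p q (segment_point a b t) =
  line_path (orient p q a) (orient p q b) t.
Proof. by rewrite /orient /segment_point /line_path /=; ring. Qed.

Lemma orient_segment_point0 a b t : orient a b (segment_point a b t) = 0.
Proof. by rewrite /orient /segment_point /line_path /=; ring. Qed.

(** If no test separates, the tests along the normals give parameters t0 and s0
at which each segment meets the line through the other. For segments in
different directions these parameters describe the same point. Otherwise all
four endpoints are on one line, and parameters at which one coordinate agrees
serve: the first one, unless it is constant on both segments. *)
Lemma segments_meetP a b p q :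
  segment a b `&` segment p q !=set0 <-> ~~ separated a b p q.
Proof.
rewrite /separated negb_or (negb_or (same_sign (orient p q a) _)).
rewrite (negb_or (gap a.1 _ _ _)); split=> [[_ [[s s01 <-] [t t01 e]]]|].
  move: s01 t01; rewrite /= !in_itv /= => s01 t01.
  have {}e : segment_point p q t = segment_point a b s by [].
  apply/and4P; split.
  - by apply/same_signP; exists t; rewrite // -orient_segment_point e
      orient_segment_point0.
  - by apply/same_signP; exists s; rewrite // -orient_segment_point -e
      orient_segment_point0.
  - by apply/gapP; exists s, t; case: e.
  - by apply/gapP; exists s, t; case: e.
case/and4P=> /same_signP[t0 t01 tE] /same_signP[s0 s01 sE].
move=> /gapP[s1 [t1 [s101 t101 e1]]] /gapP[s2 [t2 [s201 t201 e2]]].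
suff [s [t [s01' t01' e]]] : exists s t, [/\ 0 <= s <= 1, 0 <= t <= 1 &
    segment_point a b s = segment_point p q t].
  exists (segment_point a b s); split.
    by exists s => //=; rewrite in_itv.
  by exists t; rewrite /= ?in_itv.
(* w is the cross product of the directions, and (X s t, Y s t) is the vector
   joining the points at parameters s and t. *)
pose w := (b.1 - a.1) * (q.2 - p.2) - (b.2 - a.2) * (q.1 - p.1).
pose X s t := line_path p.1 q.1 t - line_path a.1 b.1 s.
pose Y s t := line_path p.2 q.2 t - line_path a.2 b.2 s.
have abE s t : (b.1 - a.1) * Y s t - (b.2 - a.2) * X s t =
    line_path (orient a b p) (orient a b q) t0 + (t - t0) * w.
  by rewrite /X /Y /w /orient /line_path; ring.
have pqE s t : (q.1 - p.1) * Y s t - (q.2 - p.2) * X s t =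
    - line_path (orient p q a) (orient p q b) s0 + (s - s0) * w.
  by rewrite /X /Y /w /orient /line_path; ring.
have point_eq s t : X s t = 0 -> Y s t = 0 ->
    segment_point a b s = segment_point p q t.
  by move=> /eqP + /eqP; rewrite !subr_eq0 /segment_point => /eqP-> /eqP->.
have [w0|w0] := eqVneq w 0; last first.
  exists s0, t0; split=> //; have := pqE s0 t0; have := abE s0 t0.
  rewrite !subrr !mul0r !addr0 tE sE oppr0 => ab0 pq0.
  apply: point_eq; apply: (mulfI w0); rewrite mulr0 /w.
    (* Cramer's rule: ab0 and pq0 are linear in X and Y, with determinant w. *)
    transitivity ((q.1 - p.1) * ((b.1 - a.1) * Y s0 t0 - (b.2 - a.2) * X s0 t0) -
                  (b.1 - a.1) * ((q.1 - p.1) * Y s0 t0 - (q.2 - p.2) * X s0 t0)).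
      by ring.
    by rewrite ab0 pq0 !mulr0 subrr.
  transitivity ((q.2 - p.2) * ((b.1 - a.1) * Y s0 t0 - (b.2 - a.2) * X s0 t0) -
                (b.2 - a.2) * ((q.1 - p.1) * Y s0 t0 - (q.2 - p.2) * X s0 t0)).
    by ring.
  by rewrite ab0 pq0 !mulr0 subrr.
have X1 : X s1 t1 = 0 by rewrite /X e1 subrr.
have [/andP[/eqP b1 /eqP q1]|] := boolP ((b.1 - a.1 == 0) && (q.1 - p.1 == 0)).
  exists s2, t2; split=> //; apply: point_eq; last by rewrite /Y e2 subrr.
  by rewrite -X1 /X !line_pathEl b1 q1 !mulr0.
(* The first coordinate varies on one of the segments. *)
rewrite negb_and => d1; exists s1, t1; split=> //.
apply: point_eq => //; apply/eqP; move: d1.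
have := pqE s1 t1; have := abE s1 t1.
rewrite w0 X1 tE sE !mulr0 !subr0 !addr0 oppr0 => /eqP + /eqP.
by rewrite !mulf_eq0; case: (Y s1 t1 == 0) => //; do 2!case: (_ - _ == 0).
Qed.

(** Twelve signs, each of rank at most 3; the comparisons of coordinates have
rank 2 and are padded with zeros. *)
Lemma few_traces_separated (I J : finType) (a b : I -> R * R)
    (p q : J -> R * R) :
  few_traces 36 (fun i j => separated (a i) (b i) (p j) (q j)).
Proof.
have gap_few (x y : I -> R) (z t : J -> R) :
    few_traces 6 (fun i j => gap (x i) (y i) (z j) (t j)).
  apply: (@few_traces_op _ _ orb 3 3); apply: (@few_traces_gt0 R).
    apply: (@rank_le3 _ _ _ (fun=> 1) (fun i => - Num.max (x i) (y i)) (fun=> 0)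
      (fun j => Num.min (z j) (t j)) (fun=> 1) (fun=> 0)) => i j; ring.
  apply: (@rank_le3 _ _ _ (fun i => Num.min (x i) (y i)) (fun=> 1) (fun=> 0)
    (fun=> 1) (fun j => - Num.max (z j) (t j)) (fun=> 0)) => i j; ring.
have rank_ab (r : J -> R * R) : rank_le 3 (fun i j => orient (a i) (b i) (r j)).
  apply: (@rank_le3 _ _ _ (fun i => (b i).1 - (a i).1)
     (fun i => (a i).2 - (b i).2)
     (fun i => ((b i).2 - (a i).2) * (a i).1 - ((b i).1 - (a i).1) * (a i).2)
     (fun j => (r j).2) (fun j => (r j).1) (fun=> 1)) => i j.
  by rewrite /orient; ring.
have rank_pq (r : I -> R * R) : rank_le 3 (fun i j => orient (p j) (q j) (r i)).
  apply: (@rank_le3 _ _ _ (fun i => (r i).2) (fun i => (r i).1) (fun=> 1)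
     (fun j => (q j).1 - (p j).1) (fun j => (p j).2 - (q j).2)
     (fun j => ((q j).2 - (p j).2) * (p j).1 - ((q j).1 - (p j).1) * (p j).2))
     => i j.
  by rewrite /orient; ring.
apply: (@few_traces_op _ _ orb 12 24).
  exact: (@few_traces_same_sign _ _ _ 3).
apply: (@few_traces_op _ _ orb 12 12).
  exact: (@few_traces_same_sign _ _ _ 3).
exact: (@few_traces_op _ _ orb 6 6).
Qed.

End Segments.

(** * The split graph of all subsets *)

Lemma intersection_model_range (T : finType) (e : rel T) (U : Type)
    (f : T -> set U) : inhabited T -> injective f ->
  (forall x y, e x y <-> x <> y /\ f x `&` f y !=set0) ->
  intersection_model e (range f).
Proof.
move=> [x0] f_inj f_adj; split; first by exists (f x0), x0.
have rf x : f x \in range f by rewrite inE; exists x.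
exists (fun x => SigSub (rf x)); last first.
  move=> x y; rewrite f_adj /Int_adj /=; split=> -[xy fxy]; split=> //.
    by move=> /(congr1 val)/f_inj.
  by move=> e_xy; apply: xy; rewrite e_xy.
have pre (A : range f) : exists x, f x = val A.
  by have [x _ fx] := set_valP A; exists x.
have [g gE] := choice pre.
by exists g => [x|A]; [apply: f_inj; rewrite gE|apply: val_inj; rewrite /= gE].
Qed.

Section SplitGraph.
Variable m : nat.

Definition split_vertex : finType := ('I_m + {set 'I_m})%type.

Definition split_adj (x y : split_vertex) : bool :=
  match x, y with
  | inl _, inl _ => false
  | inl i, inr A | inr A, inl i => i \in A
  | inr A, inr B => A != B
  end.

Lemma split_adj_sym : symmetric split_adj.
Proof. by case=> [i|A] [j|B] //=; rewrite eq_sym. Qed.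

Lemma split_adj_irr : irreflexive split_adj.
Proof. by case=> [i|A] //=; rewrite eqxx. Qed.

(** The non-neighbourhoods of the clique vertices in the independent part are the
traces of a separation relation, and there are 2 ^ m of them. *)
Lemma split_not_segment (R : realType) :
  (m.+1 ^ 36 < 2 ^ m)%N -> ~ segment_graph R split_adj.
Proof.
move=> m_large [F [[_ [f /bij_inj f_inj f_adj]] Fseg]].
have ends (x : split_vertex) : exists pq : (R * R) * (R * R),
    val (f x) = segment pq.1 pq.2.
  have [|a [b ab]] := Fseg (val (f x)); first exact: set_valP.
  by exists (a, b).
have [pq pqE] := choice ends.
pose far i A := separated (pq (inl i)).1 (pq (inl i)).2
                          (pq (inr A)).1 (pq (inr A)).2.
have farE i (A : {set 'I_m}) : far i A = (i \notin A).
  apply/negb_inj; rewrite negbK; apply/idP/idP => [iA|iA].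
    apply/(f_adj (inl i) (inr A)); split; first by move=> /f_inj.
    by rewrite !pqE; apply/segments_meetP.
  have [_] := (f_adj (inl i) (inr A)).1 iA.
  by rewrite !pqE => /segments_meetP.
have := few_traces_separated (fun i => (pq (inl i)).1) (fun i => (pq (inl i)).2)
  (fun A => (pq (inr A)).1) (fun A => (pq (inr A)).2).
rewrite /few_traces card_ord leqNgt => /negP; apply.
rewrite card_imset; last first.
  move=> A B AB; apply/setP => i; apply/negb_inj; rewrite -!farE.
  by have := congr1 (fun X : {set 'I_m} => i \in X) AB; rewrite !inE.
by rewrite -cardsT -powersetT card_powerset cardsT card_ord.
Qed.

(** * An outer-string model *)

Section OuterString.
Variable R : realType.

Definition arc (t : R) : R * R := (t, Num.sqrt (1 - t ^+ 2)).

Lemma arc_norm t : 0 <= t <= 1 -> (arc t).1 ^+ 2 + (arc t).2 ^+ 2 = 1.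
Proof.
by move=> t01; rewrite /= sqr_sqrtr ?subrKC // subr_ge0; nra.
Qed.

(** Distinct positive parameters: 0 is kept for the point common to all the curves
that model the clique. *)
Definition knot (x : split_vertex) : R := (enum_rank x).+1%:R^-1.

Lemma knot_itv x : 0 < knot x <= 1.
Proof. by rewrite invr_gt0 ltr0n /= invf_le1 ?ltr0n ?ler1n. Qed.

Lemma knot_itvW x : 0 <= knot x <= 1.
Proof. by have /andP[/ltW -> ->] := knot_itv x. Qed.

Lemma knot_inj : injective knot.
Proof.
move=> x y /invr_inj /eqP; rewrite eqr_nat => /eqP[] /val_inj.
exact: enum_rank_inj.
Qed.

Definition touch_params (A : {set 'I_m}) : seq R :=
  [:: 0, knot (inr A) & [seq knot (inl i) | i <- enum A]].

Lemma touch_itv A t : t \in touch_params A -> 0 <= t <= 1.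
Proof.
rewrite !inE => /or3P[/eqP ->|/eqP ->|/mapP[i _ ->]]; rewrite ?knot_itvW //.
by rewrite lexx ler01.
Qed.

Lemma knot_inl_touch A i : (knot (inl i) \in touch_params A) = (i \in A).
Proof.
have /andP[k0 _] := knot_itv (inl i).
rewrite !inE gt_eqF //= (inj_eq knot_inj) /=.
rewrite (@mem_map _ _ (fun i => knot (inl i))) ?mem_enum //.
by move=> j k /knot_inj [].
Qed.

Lemma knot_inr_touch A B : (knot (inr A) \in touch_params B) = (A == B).
Proof.
have /andP[k0 _] := knot_itv (inr A).
rewrite !inE gt_eqF //= (inj_eq knot_inj); case: eqP => [[->]|AB].
  by rewrite eqxx.
apply/mapP/eqP => [[i _ /knot_inj]|E] //; by case: AB; rewrite E.
Qed.

Definition touch_poly A : {poly R} := \prod_(t <- touch_params A) ('X - t%:P).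

(** Each factor has absolute value at most 1 on [0, 1]; this keeps the radius of
the strings in [0, 1]. *)
Lemma norm_prod_XsubC_le1 (s : seq R) t : 0 <= t <= 1 ->
  (forall u, u \in s -> 0 <= u <= 1) ->
  `|(\prod_(u <- s) ('X - u%:P)).[t]| <= 1.
Proof.
move=> t01; elim: s => [|u s IHs] s01; first by rewrite big_nil hornerC normr1.
rewrite big_cons hornerM hornerXsubC normrM mulr_ile1 //.
  have := s01 u (mem_head _ _); rewrite ler_norml; lra.
by apply: IHs => v vs; rewrite s01 // inE vs orbT.
Qed.

Lemma string_radius_itv A t :
  0 <= t <= 1 -> 0 <= 1 - (touch_poly A).[t] ^+ 2 <= 1.
Proof.
move=> t01; rewrite lerBlDr lerDl sqr_ge0 andbT subr_ge0.
rewrite -real_normK ?num_real // exprn_ile1 //.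
by apply: norm_prod_XsubC_le1 => // u; apply: touch_itv.
Qed.

(** The squared norm of the result is the squared radius, which is 1 exactly at the
roots of the touching polynomial. *)
Definition string_point A t : R * R :=
  let r := 1 - (touch_poly A).[t] ^+ 2 in (r * (arc t).1, r * (arc t).2).

Definition string (x : split_vertex) : set (R * R) :=
  match x with
  | inl i => [set arc (knot (inl i))]
  | inr A => string_point A @` `[0, 1]
  end.

Lemma string_point_norm A t : 0 <= t <= 1 ->
  (string_point A t).1 ^+ 2 + (string_point A t).2 ^+ 2 =
  (1 - (touch_poly A).[t] ^+ 2) ^+ 2.
Proof. by move=> /arc_norm t1; rewrite !exprMn -mulrDr t1 mulr1. Qed.

(** A point of the string at norm 1 is at radius 1, so its parameter is a root of
the touching polynomial; the first coordinate recovers the parameter. *)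
Lemma arc_string A t : 0 <= t <= 1 ->
  string (inr A) (arc t) <-> t \in touch_params A.
Proof.
move=> t01; split=> [[u]|tA].
  rewrite /= in_itv /= => u01 utE.
  have /andP[r0 _] := string_radius_itv A u01.
  have := string_point_norm A u01; rewrite utE arc_norm // => /esym/eqP.
  rewrite pexpr_eq1 //= => /eqP r1.
  move: utE; rewrite /string_point r1 !mul1r => -[<- _].
  rewrite -root_prod_XsubC; apply/rootP/eqP.
  by rewrite -sqrf_eq0; apply/eqP; lra.
exists t; first by rewrite /= in_itv.
have : root (touch_poly A) t by rewrite root_prod_XsubC.
by move=> /rootP e; rewrite /string_point e expr0n subr0 !mul1r.
Qed.

Lemma arc0_string A : string (inr A) (arc 0).
Proof. by apply/arc_string; rewrite ?lexx ?ler01 // inE eqxx. Qed.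

Lemma string_inl_inr i A :
  string (inl i) `&` string (inr A) !=set0 <-> i \in A.
Proof.
have k01 := knot_itvW (inl i); rewrite -knot_inl_touch; split.
  by move=> [_ [-> /arc_string]]; apply.
by move=> /arc_string iA; exists (arc (knot (inl i))); split=> //; apply: iA.
Qed.

Lemma string_adj x y : split_adj x y <->
  x <> y /\ string x `&` string y !=set0.
Proof.
case: x y => [i|A] [j|B] /=.
- by split=> // -[ij [_ [-> [/knot_inj /ij]]]].
- by rewrite -string_inl_inr; split=> [|[]].
- by rewrite -string_inl_inr setIC; split=> [|[]].
- split=> [/eqP AB|[AB _]]; last by apply/eqP => e; case: AB; rewrite e.
  by split; [case|exists (arc 0); split; apply: arc0_string].
Qed.

Lemma string_inj : injective string.
Proof.
have inl_inr i A : string (inl i) <> string (inr A).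
  move=> iA; have := arc0_string A; rewrite -iA => -[/esym k0 _].
  by have := knot_itv (inl i); rewrite k0 ltxx.
move=> [i|A] [j|B] // e.
- have : string (inl j) (arc (knot (inl i))) by rewrite -e.
  by move=> [/knot_inj ->].
- by case: (inl_inr i B).
- by case: (inl_inr j A).
have : string (inr B) (arc (knot (inr A))).
  by rewrite -e; apply/arc_string; rewrite ?knot_itvW // knot_inr_touch.
by move/arc_string; rewrite knot_itvW knot_inr_touch => /(_ isT)/eqP ->.
Qed.

Lemma continuous_string_point A : continuous (string_point A).
Proof.
have radius_cont : continuous (fun t => 1 - (touch_poly A).[t] ^+ 2).
  rewrite (_ : (fun t => _) = horner (1 - touch_poly A ^+ 2)).
    exact: continuous_horner.
  by apply/funext => t; rewrite hornerD hornerN hornerC horner_exp.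
have sqr_cont : continuous (fun t : R => 1 - t ^+ 2).
  rewrite (_ : (fun t => _) = horner (1 - 'X ^+ 2)).
    exact: continuous_horner.
  by apply/funext => t; rewrite hornerD hornerN hornerC hornerXn.
move=> t.
have cont1 : {for t, continuous (fun t => (string_point A t).1)}.
  exact: (continuousM (radius_cont t) (@cvg_id _ _)).
have cont2 : {for t, continuous (fun t => (string_point A t).2)}.
  apply: (continuousM (radius_cont t)).
  exact: (continuous_comp (sqr_cont t) (@sqrt_continuous R _)).
exact: (cvg_pair cont1 cont2).
Qed.

Lemma string_grounded x : grounded_curve (0, 0) 1 (string x).
Proof.
case: x => [i|A].
  exists (fun=> arc (knot (inl i))); split.
  - exact/continuous_subspaceT/cst_continuous.
  - apply/seteqP; split=> [_ ->|_ [t _ <-]] //.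
    by exists 0; rewrite //= in_itv /= lexx ler01.
  - move=> _ ->.
    by rewrite /disk /sqr_dist /= !subr0 arc_norm ?knot_itvW // expr1n.
  - by left; rewrite /circle /sqr_dist /= !subr0 arc_norm ?knot_itvW // expr1n.
exists (string_point A); split=> //.
- exact/continuous_subspaceT/continuous_string_point.
- move=> _ [t + <-]; rewrite /= in_itv /= => t01.
  rewrite /disk /sqr_dist /= !subr0 string_point_norm // expr1n exprn_ile1 //.
    by have /andP[] := string_radius_itv A t01.
  by have /andP[] := string_radius_itv A t01.
left; rewrite /circle /sqr_dist /= !subr0 string_point_norm ?lexx ?ler01 //.
rewrite (_ : _.[0] = 0) ?expr0n ?subr0 //.
by apply/rootP; rewrite root_prod_XsubC inE eqxx.
Qed.

End OuterString.

Lemma split_outer_string (R : realType) : outer_string_graph R split_adj.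
Proof.
exists (range (@string R)); split; last first.
  by exists (0, 0), 1 => // _ [x _ <-]; apply: string_grounded.
apply: intersection_model_range; first exact: (inhabits (inr finset.set0)).
  exact: string_inj.
exact: string_adj.
Qed.

End SplitGraph.

Theorem theorem11 (R : realType) :
  exists (T : finType) (e : rel T),
    [/\ symmetric e, irreflexive e,
        outer_string_graph R e & ~ segment_graph R e].
Proof.
exists (split_vertex 400), (@split_adj 400).
split.
- exact: split_adj_sym.
- exact: split_adj_irr.
- exact: split_outer_string.
apply: split_not_segment.
(* 401 <= 2 ^ 9 and 9 * 36 = 324 < 400. *)
apply: (@leq_ltn_trans ((2 ^ 9) ^ 36)); first by rewrite leq_exp2r.
by rewrite -expnM ltn_exp2l.
Qed.
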